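(* For every decreasing tableau $P$, removable cell $(r,c)$ of $P$ and $\alpha\in\{0,1\}$, the reverse insertion $\Psi(P,(r,c),\alpha)=(P',m)$ is well-defined; in particular $P'$ is a decreasing tableau (of shape $\mathrm{shape}(P)$ if $\alpha=0$ and $\mathrm{shape}(P)\setminus\{(r,c)\}$ if $\alpha=1$).
   Context: Tableaux use English notation; cell $(i,j)$ is in row $i$, column $j$. A decreasing tableau is a filling of the diagram of a partition by positive integers strictly decreasing from left to right along rows and from top to bottom along columns. A cell is removable if it is the last cell of its row and the bottom cell of its column. $P_{>r}$ denotes the tableau obtained by deleting the first $r$ rows of $P$ (rows renumbered from 1). A value $x$ is $P$-ejectable if $x$ occurs in the first row of $P$ and either $x-1$ does not occur in the first row, or $x-1$ occurs in the first row and $x-1$ is $P_{>1}$-ejectable (nothing is ejectable in the empty tableau). Bumping path of a removable cell $(r,c)$ of $P$: $m_r$ is the entry at $(r,c)$, and for $i=r-1,\dots,1$, $m_i$ is the smallest entry of row $i$ with $m_i>m_{i+1}$. Reverse insertion $\Psi(P,(r,c),\alpha)=(P',m)$: compute the bumping path $m_r<\dots<m_1$; set $m:=m_1$, $P':=P$. If $\alpha=1$, delete cell $(r,c)$ from $P'$, set $\alpha_r=1$, and process rows $i=r-1,\dots,1$. If $\alpha=0$, set $m_{r+1}=0$, $\alpha_{r+1}=0$, and process rows $i=r,\dots,1$. Processing row $i$ with $R$ the set of entries of row $i$ of $P$: (D) if $m_i-1\in R$, leave row $i$, $\alpha_i=\alpha_{i+1}$; (DR) else if $\alpha_{i+1}=1$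 and $m_{i+1}\notin R$, replace $m_i$ in row $i$ of $P'$ by $m_{i+1}$, $\alpha_i=1$; otherwise let $x$ be the smallest $P'_{>i}$-ejectable value (current $P'$) with $m_{i+1}<x<m_i$: (IR) if $x$ exists replace $m_i$ by $x$, $\alpha_i=1$; (NR) else leave row $i$, $\alpha_i=0$. Output final $P'$ and $m$. *)

(* Defs.v *)
From mathcomp Require Import all_boot.

Set Implicit Arguments.
Unset Strict Implicit.
Unset Printing Implicit Defensive.

(* A filling is the list of its rows from top to bottom, each row being listed
   from left to right.  Rows and columns are numbered from 0, so that P_{>r} in
   the usual 1-based numbering is [drop r P], and the rows strictly below row i
   in the 0-based numbering are [drop i.+1 P].  A partition is the sequence of
   its (nonzero) parts; [shape P] is the sequence of the row lengths of P. *)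
Definition tableau := seq (seq nat).

Definition trow (P : tableau) (i : nat) : seq nat := nth [::] P i.
Definition entry (P : tableau) (i j : nat) : nat := nth 0 (trow P i) j.

Definition is_partition (sh : seq nat) : bool :=
  sorted geq sh && (0 \notin sh).

Definition in_diagram (sh : seq nat) : pred (nat * nat) :=
  fun ij => ij.2 < nth 0 sh ij.1.

Definition decreasing_tableau (P : tableau) : Prop :=
  [/\ is_partition (shape P),
      forall i j, in_diagram (shape P) (i, j) -> 0 < entry P i j,
      forall i j, in_diagram (shape P) (i, j.+1) ->
        entry P i j.+1 < entry P i j
    & forall i j, in_diagram (shape P) (i.+1, j) ->
        entry P i.+1 j < entry P i j].

Definition removable (P : tableau) (r c : nat) : bool :=
  [&& in_diagram (shape P) (r, c),
      ~~ in_diagram (shape P) (r, c.+1)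
    & ~~ in_diagram (shape P) (r.+1, c)].

(* On positive fillings the truncation in [x.-1] is harmless: for x = 1 the
   value 0 does not occur. *)
Fixpoint ejectable (P : tableau) (x : nat) : bool :=
  if P is R :: Q then
    (x \in R) &&
    ((x.-1 \notin R) || ((x.-1 \in R) && ejectable Q x.-1))
  else false.

Definition smallest (s : seq nat) : option nat := ohead (sort leq s).

(* [bumping_path P r c] is [Some [:: m_0; ...; m_r]], in order of increasing
   row index, or [None] when some row above row r has no entry larger than the
   path entry just below it.  The [foldr] visits rows r-1, ..., 0 in turn. *)
Definition bump_row (R : seq nat) (path : option (seq nat)) :
    option (seq nat) :=
  if path is Some (m :: ms) then
    omap (fun x => [:: x, m & ms]) (smallest [seq x <- R | m < x])
  else None.

Definition bumping_path (P : tableau) (r c : nat) : option (seq nat) :=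
  foldr bump_row (omap (fun m => [:: m]) (onth (trow P r) c)) (take r P).

(* For a removable cell (r, c), [take c] removes exactly that cell; if this
   empties row r (then necessarily the last one), the row disappears. *)
Definition delete_cell (P : tableau) (r c : nat) : tableau :=
  [seq R <- set_nth [::] P r (take c (trow P r)) | R != [::]].

Definition replace_in_row (P : tableau) (i old new : nat) : tableau :=
  set_nth [::] P i [seq (if y == old then new else y) | y <- trow P i].

(* The state is the current tableau P' together with the flag alpha_{i+1}; the
   returned flag is alpha_i.  [ms] is the bumping path, and [nth 0 ms r.+1] is
   the convention m_{r+1} = 0. *)
Definition process_row (P : tableau) (ms : seq nat) (i : nat)
    (st : tableau * bool) : tableau * bool :=
  let: (P', a) := st in
  let R := trow P i in
  let m := nth 0 ms i in
  let mbelow := nth 0 ms i.+1 in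
  if m.-1 \in R then (P', a)
  else if a && (mbelow \notin R) then (replace_in_row P' i m mbelow, true)
  else if smallest [seq x <- iota 0 m |
                     (mbelow < x) && ejectable (drop i.+1 P') x] is Some x
       then (replace_in_row P' i m x, true)
  else (P', false).

(* alpha is encoded as a boolean, [true] for 1.  [None] means that the bumping
   path is undefined.  The [foldr] visits rows r-1, ..., 0 if alpha = 1 and
   rows r, ..., 0 if alpha = 0. *)
Definition reverse_insertion (P : tableau) (r c : nat) (alpha : bool) :
    option (tableau * nat) :=
  omap (fun ms =>
    let st :=
      if alpha
      then foldr (process_row P ms) (delete_cell P r c, true) (iota 0 r)
      else foldr (process_row P ms) (P, false) (iota 0 r.+1)
    in (st.1, nth 0 ms 0))
    (bumping_path P r c).

(* Main.v *)
Require Import Defs.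
From mathcomp Require Import all_boot.

Set Implicit Arguments.
Unset Strict Implicit.
Unset Printing Implicit Defensive.

(** The entries only decrease during reverse insertion, so only a row i whose
    entry m_i has just been replaced by some x needs checking.  Since m_i is the
    smallest entry of its row above m_{i+1}, its right neighbour is at most
    m_{i+1} and the cell below it contained at most m_{i+1}.  Hence all is well
    if x > m_{i+1}, whether or not x is ejectable.  In case (DR), where
    x = m_{i+1}, the danger is that m_{i+1} still sits right below; then
    alpha_{i+1} = 1 was inherited through (D), so m_{i+1} - 1 lies further right
    in row i+1 of P, and the entry of row i above it is squeezed to be m_{i+1},
    contradicting the hypothesis of (DR). *)

Arguments trow : simpl never.
Arguments entry : simpl never.

(** * Decreasing tableaux in terms of row lengths *)

Lemma nth_shape P i : nth 0 (shape P) i = size (trow P i).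
Proof.
rewrite /trow; have [lt_iP | le_Pi] := ltnP i (size P).
  by rewrite (nth_map [::]).
by rewrite !nth_default ?size_map.
Qed.

Lemma mem_trow P i y :
  reflect (exists2 k, k < size (trow P i) & entry P i k = y) (y \in trow P i).
Proof. exact: (nthP 0). Qed.

Lemma mem_entry P i k : k < size (trow P i) -> entry P i k \in trow P i.
Proof. exact: mem_nth. Qed.

(** Row strictness is iterated from neighbouring to arbitrary columns, the form in which entries of
    one row are compared later. *)
Lemma decreasing_tableauP P :
  decreasing_tableau P <->
  [/\ is_partition (shape P),
      forall i k, k < size (trow P i) -> 0 < entry P i k,
      forall i k l, l < size (trow P i) -> k < l -> entry P i l < entry P i k
    & forall i k, k < size (trow P i.+1) -> entry P i.+1 k < entry P i k].
Proof.
rewrite /decreasing_tableau /in_diagram /=; split=> -[part pos row col].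
  split=> [//|i k|i k l|i k]; rewrite -?nth_shape; [exact: pos| |exact: col].
  elim: l => // l IHl lt_l; rewrite ltnS leq_eqVlt => /predU1P[-> | lt_kl].
    exact: row.
  exact: ltn_trans (row _ _ lt_l) (IHl (ltnW lt_l) lt_kl).
split=> [//|i k|i k|i k]; rewrite nth_shape; [exact: pos| |exact: col].
by move=> lt_k; apply: row.
Qed.

Lemma is_partition_shape P :
  is_partition (shape P) <->
  [::] \notin P /\ forall i, size (trow P i.+1) <= size (trow P i).
Proof.
have zero_shape : (0 \in shape P) = ([::] \in P).
  apply/mapP/idP=> [[[|//] nilP _] // | nilP]; by exists [::].
rewrite /is_partition zero_shape; split=> [/andP[/(sortedP 0) srt ->]|[-> le_sz]].
  split=> // i; rewrite -!nth_shape; have [|ge_i] := ltnP i.+1 (size (shape P)).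
    exact: srt.
  by rewrite nth_default.
by rewrite andbT; apply/(sortedP 0) => i _; rewrite !nth_shape; apply: le_sz.
Qed.

Lemma size_trowS P i :
  is_partition (shape P) -> size (trow P i.+1) <= size (trow P i).
Proof. by case/is_partition_shape=> _; apply. Qed.

Lemma trow_neq0 P i :
  is_partition (shape P) -> (0 < size (trow P i)) = (i < size P).
Proof.
case/andP=> _ no0; have [lt_iP | le_Pi] := ltnP i (size P); last first.
  by rewrite /trow nth_default.
rewrite lt0n; apply: contra no0 => /eqP <-.
by rewrite -nth_shape mem_nth // size_map.
Qed.

Lemma decreasing_tableau_behead R P :
  decreasing_tableau (R :: P) -> decreasing_tableau P.
Proof.
case=> /andP[srt no0] pos row col; split.
- rewrite /is_partition (path_sorted srt) /=.
  by apply: contra no0; rewrite inE orbC => ->.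
- by move=> i; apply: (pos i.+1).
- by move=> i; apply: (row i.+1).
- by move=> i; apply: (col i.+1).
Qed.

(** * Smallest elements and existence of the bumping path *)

Lemma smallest_some s x :
  smallest s = Some x -> x \in s /\ {in s, forall y, x <= y}.
Proof.
rewrite /smallest; have mem_s := mem_sort leq s.
have := sort_sorted leq_total s.
case: (sort leq s) mem_s => //= y t mem_s.
rewrite (path_sortedE leq_trans) => /andP[/allP min_y _] [<-].
split=> [|z]; rewrite -mem_s inE ?eqxx // => /predU1P[-> //|]; exact: min_y.
Qed.

Lemma smallest_exists s y : y \in s -> exists x, smallest s = Some x.
Proof.
rewrite -(mem_sort leq) /smallest; case: (sort leq s) => // x t _.
by exists x.
Qed.

Definition least_above (R : seq nat) (b m : nat) : Prop :=
  [/\ m \in R, b < m & {in R, forall y, b < y -> m <= y}].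

(** The search never fails: by column strictness the entry directly above a path entry is larger, so
    the row above always offers a candidate. *)
Lemma bumping_path_some P r c :
  decreasing_tableau P -> c < size (trow P r) ->
  exists ms, [/\ bumping_path P r c = Some ms, nth 0 ms r = entry P r c,
    nth 0 ms r.+1 = 0
    & forall i, i < r -> least_above (trow P i) (nth 0 ms i.+1) (nth 0 ms i)].
Proof.
elim: P r => [|R P IHP] [|r] //= decP lt_c.
  exists [:: nth 0 R c]; split=> //.
  by rewrite /bumping_path /= onthE (nth_map 0).
have [[|m ms] [path_ms ms_r ms_r1 msP]] :=
    IHP r (decreasing_tableau_behead decP) lt_c.
  (* An empty path would read as the default 0 at row [r], whereas entries are positive. *)
  suff: 0 < entry P r c by rewrite -ms_r nth_nil.
  by case/decreasing_tableauP: decP => _ /(_ r.+1) pos _ _; apply: pos.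
have memP : m \in trow P 0.
  case: r {path_ms ms_r1} lt_c ms_r msP => [|r] lt_c /= ms_r msP.
    by rewrite ms_r mem_entry.
  by have [] := msP 0 isT.
have [k lt_k Dm] := mem_trow _ _ _ memP.
case/decreasing_tableauP: decP => part _ _ col.
have lt_kR : k < size R.
  case/andP: part => /= + _; case: (P) lt_k => //= R' Q lt_k /andP[le_R' _].
  exact: leq_trans lt_k le_R'.
have lt_mR : m < nth 0 R k by rewrite -Dm; apply: (col 0).
have [|x Dx] := @smallest_exists [seq x <- R | m < x] (nth 0 R k).
  by rewrite mem_filter lt_mR mem_nth.
exists [:: x, m & ms]; split=> //.
  by move: path_ms; rewrite /bumping_path /= => -> /=; rewrite Dx.
case=> [_|i lt_i]; last exact: msP.
have [+ min_x] := smallest_some Dx.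
rewrite mem_filter => /andP[lt_mx xR]; split=> // y yR lt_my.
by apply: min_x; rewrite mem_filter lt_my.
Qed.

(** * Replacing an entry, and the invariant of reverse insertion *)

Lemma trow_replace P i old new j :
  trow (replace_in_row P i old new) j =
    if j == i then [seq if y == old then new else y | y <- trow P i]
    else trow P j.
Proof. by rewrite /trow nth_set_nth. Qed.

Lemma shape_replace P i old new :
  i < size P -> shape (replace_in_row P i old new) = shape P.
Proof.
move=> lt_iP; have sz : size (replace_in_row P i old new) = size P.
  by rewrite size_set_nth; apply/maxn_idPr.
apply: (@eq_from_nth _ 0); rewrite ?size_map // => j _.
by rewrite !nth_shape trow_replace; case: eqP => // ->; rewrite size_map.
Qed.

(* [st] is the state reached after the rows of index at least [i] have been
   processed, and [sh] is the shape of the tableau being built. *)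
Definition processed_from (P : tableau) (ms sh : seq nat) (i : nat)
    (st : tableau * bool) : Prop :=
  [/\ shape st.1 = sh,
      forall j, j < i -> trow st.1 j = trow P j,
      forall j k, i <= j -> k < size (trow st.1 j) -> 0 < entry st.1 j k,
      forall j k l, i <= j -> l < size (trow st.1 j) -> k < l ->
        entry st.1 j l < entry st.1 j k
    & forall j k, i <= j -> k < size (trow st.1 j.+1) ->
        entry st.1 j.+1 k < entry st.1 j k] /\
  [/\ forall k, k < size (trow st.1 i) ->
        k < size (trow P i) /\ entry st.1 i k <= entry P i k,
      st.2 -> 0 < nth 0 ms i
    & st.2 -> nth 0 ms i \in trow st.1 i -> (nth 0 ms i).-1 \in trow P i].

(** * Processing one row preserves the invariant *)

Section Step.

Variables (P : tableau) (ms sh : seq nat) (i : nat).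
Let m := nth 0 ms i.
Let b := nth 0 ms i.+1.
Hypotheses (decP : decreasing_tableau P) (m_least : least_above (trow P i) b m).

(** Covers (D) and (NR). Row [i] stays as in [P] while the row below can only have decreased, so
    columns remain strict. The condition on [a'] is the test of (D), and is vacuous in (NR). *)
Lemma processed_keep P' a (a' : bool) :
  processed_from P ms sh i.+1 (P', a) ->
  (a' -> m.-1 \in trow P i) ->
  processed_from P ms sh i (P', a').
Proof.
have [mR lt_bm _] := m_least.
case/decreasing_tableauP: (decP) => _ pos row col.
case=> -[/= shP' same pos' row' col'] [le_row _ _] a'D.
have eq_i : trow P' i = trow P i by apply: same.
have eq_e k : entry P' i k = entry P i k by rewrite /entry eq_i.
split; split=> //=.
- by move=> j lt_j; apply/same/ltnW.
- move=> j k; rewrite leq_eqVlt => /predU1P[<-|]; last exact: pos'.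
  by rewrite eq_i eq_e; apply: pos.
- move=> j k l; rewrite leq_eqVlt => /predU1P[<-|]; last exact: row'.
  by rewrite eq_i !eq_e; apply: row.
- move=> j k; rewrite leq_eqVlt => /predU1P[<-|]; last exact: col'.
  rewrite eq_e => /le_row[lt_k le_k].
  exact: leq_ltn_trans le_k (col _ _ lt_k).
- by move=> k; rewrite eq_i eq_e.
- by move=> _; apply: leq_ltn_trans lt_bm.
- by move=> /a'D.
Qed.

(** Covers (DR), with [x = b], and (IR), with [b < x]. The last two hypotheses protect the row and
    the column of the new entry. As [x < m], the value [m] leaves row [i], so the last clause of the
    invariant holds vacuously. *)
Lemma processed_replace P' a x :
  processed_from P ms sh i.+1 (P', a) ->
  0 < x -> b <= x < m -> (x = b -> b \notin trow P i) ->
  (forall k, k < size (trow P' i.+1) -> entry P i k = m ->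
    entry P' i.+1 k < x) ->
  processed_from P ms sh i (replace_in_row P' i m x, true).
Proof.
have [mR lt_bm m_min] := m_least.
case/decreasing_tableauP: (decP) => part pos row col.
case=> -[/= shP' same pos' row' col'] [le_row _ _] x_gt0 /andP[le_bx lt_xm].
move=> xb below_x.
have eq_i : trow P' i = trow P i by apply: same.
have lt_iP' : i < size P'.
  by rewrite ltnNge; apply/negP=> ge_i; move: mR; rewrite -eq_i /trow nth_default.
set P'' := replace_in_row P' i m x.
have row_i : trow P'' i = [seq if y == m then x else y | y <- trow P i].
  by rewrite trow_replace eqxx eq_i.
have row_j j : j != i -> trow P'' j = trow P' j.
  by rewrite trow_replace => /negPf->.
have ent_i k : k < size (trow P i) ->
    entry P'' i k = if entry P i k == m then x else entry P i k.
  by move=> lt_k; rewrite /entry row_i (nth_map 0).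
have ent_j j k : j != i -> entry P'' j k = entry P' j k.
  by move=> ne_ji; rewrite /entry row_j.
have sz_i : size (trow P'' i) = size (trow P i) by rewrite row_i size_map.
split; split=> //=.
- by rewrite shape_replace.
- by move=> j lt_ji; rewrite row_j ?ltn_eqF // same // ltnW.
- move=> j k; rewrite leq_eqVlt => /predU1P[<-|lt_ij].
    by rewrite sz_i => lt_k; rewrite ent_i //; case: eqP => // _; apply: pos.
  by rewrite row_j ?ent_j ?gtn_eqF //; apply: pos'.
- move=> j k l; rewrite leq_eqVlt => /predU1P[<-|lt_ij]; last first.
    by rewrite row_j ?ent_j ?gtn_eqF //; apply: row'.
  rewrite sz_i => lt_l lt_kl; have lt_k := ltn_trans lt_kl lt_l.
  have lt_e := row _ _ _ lt_l lt_kl; rewrite !ent_i //.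
  have [Dk|_] := eqVneq (entry P i k) m; have [Dl|_] := eqVneq (entry P i l) m.
  + by move: lt_e; rewrite Dk Dl ltnn.
  (* Here [x] replaces [m] in column [k]. An entry to the right is below [m], hence at most [b] by
     minimality of [m]; it could equal [x] only if [x = b] occurred in row [i]. *)
  + have lR := mem_entry lt_l.
    have le_lb : entry P i l <= b.
      rewrite leqNgt; apply/negP=> /(m_min _ lR).
      by rewrite leqNgt -Dk lt_e.
    rewrite ltn_neqAle (leq_trans le_lb) // andbT; apply/eqP=> Dx.
    have xb_eq : x = b by apply/eqP; rewrite eqn_leq le_bx -Dx le_lb.
    by case/negP: (xb xb_eq); rewrite -xb_eq -Dx.
  + by rewrite (ltn_trans lt_xm) // -Dl.
  + by [].
- move=> j k; rewrite leq_eqVlt => /predU1P[<-|lt_ij]; last first.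
    by rewrite row_j ?ent_j ?gtn_eqF ?leqW //; apply: col'.
  rewrite row_j ?(ent_j i.+1) ?gtn_eqF // => lt_k.
  have [lt_kP le_k] := le_row _ lt_k; have lt_e := col _ _ lt_kP.
  have lt_ki := leq_trans lt_kP (size_trowS i part).
  rewrite ent_i //; case: eqP => [Dm|_]; first exact: below_x.
  exact: leq_ltn_trans le_k lt_e.
- move=> k; rewrite sz_i => lt_k; split=> //; rewrite ent_i //.
  by case: eqP => // ->; apply: ltnW.
- by move=> _; apply: leq_ltn_trans lt_bm.
- move=> _; rewrite row_i => /mapP[y _]; rewrite -/m.
  by case: eqP => [_ Dm | ne_ym Dm]; [move: lt_xm; rewrite -Dm ltnn | case: ne_ym].
Qed.

(** Above row [r] this comes from [entry_below_least]; at row [r] itself, processed when alpha is 0,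
    it comes from removability. *)
Hypothesis below_m : forall k,
  k < size (trow P i.+1) -> entry P i k = m -> entry P i.+1 k <= b.

Lemma processed_step st :
  processed_from P ms sh i.+1 st ->
  processed_from P ms sh i (process_row P ms i st).
Proof.
case: st => P' a inv; rewrite /process_row -/m -/b.
have [mR lt_bm m_min] := m_least.
case/decreasing_tableauP: (decP) => part _ row col.
have [-[_ _ _ _ _] [/= le_row b_gt0 b_below]] := inv.
case: ifP => [mD | _]; first exact: processed_keep inv _.
case: ifP => [/andP[a1 bR] | _].
  rewrite a1 in inv b_gt0 b_below.
  apply: (processed_replace inv); rewrite ?leqnn ?b_gt0 //.
  move=> k lt_k Dm; have [lt_kP le_k] := le_row k lt_k.
  rewrite ltn_neqAle (leq_trans le_k (below_m lt_kP Dm)) andbT.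
  apply/eqP=> Db; case/negP: bR.
  have Pb : entry P i.+1 k = b.
    by apply/eqP; rewrite eqn_leq below_m //= -Db.
  have /b_below : b \in trow P' i.+1 by rewrite -Db mem_entry.
  rewrite -/b => /(_ isT)/mem_trow[l lt_l Dl].
  have lt_b : entry P i.+1 l < b by rewrite Dl prednK ?b_gt0.
  have lt_kl : k < l.
    rewrite ltnNge leq_eqVlt; apply/negP=> /predU1P[Dk|lt_lk].
      by move: lt_b; rewrite Dk Pb ltnn.
    by have := row _ _ _ lt_kP lt_lk; rewrite Pb ltnNge (ltnW lt_b).
  have lt_li := leq_trans lt_l (size_trowS i part).
  (* The squeeze: this entry lies over [b - 1], so it is at least [b]; it lies to the right of [m],
     so it is less than [m] and, by minimality of [m], at most [b]. *)
  suff -> : b = entry P i l by apply: mem_entry.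
  apply/eqP; rewrite eqn_leq; apply/andP; split.
    by have := col _ _ lt_l; rewrite Dl prednK ?b_gt0.
  rewrite leqNgt; apply/negP=> /(m_min _ (mem_entry lt_li)).
  by rewrite leqNgt -Dm row.
case Dx: smallest => [x|]; last exact: processed_keep inv _.
have [+ _] := smallest_some Dx.
rewrite mem_filter mem_iota add0n => /andP[/andP[lt_bx _] /= lt_xm].
apply: (processed_replace inv); first exact: leq_ltn_trans lt_bx.
- by rewrite ltnW.
- by move=> Dxb; rewrite Dxb ltnn in lt_bx.
- move=> k lt_k Dm; have [lt_kP le_k] := le_row k lt_k.
  exact: leq_ltn_trans (leq_trans le_k (below_m lt_kP Dm)) lt_bx.
Qed.

End Step.

(** * Processing all rows *)

(** If the entry under [m] exceeded [b], then [b] would lie further right in its row. The entry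
    above [b] would then be larger than [b], hence at least [m], yet it would stand to the right of
    [m]. *)
Lemma entry_below_least P i b m k :
  decreasing_tableau P -> least_above (trow P i) b m -> b \in trow P i.+1 ->
  k < size (trow P i.+1) -> entry P i k = m -> entry P i.+1 k <= b.
Proof.
case/decreasing_tableauP=> part _ row col [_ _ m_min] /mem_trow[l lt_l Dl].
move=> lt_k Dm; rewrite leqNgt; apply/negP=> lt_b.
have lt_kl : k < l.
  rewrite ltnNge leq_eqVlt; apply/negP=> /predU1P[Dk|lt_lk].
    by move: lt_b; rewrite -Dl Dk ltnn.
  by have := row _ _ _ lt_k lt_lk; rewrite Dl ltnNge (ltnW lt_b).
have lt_li := leq_trans lt_l (size_trowS i part).
have := m_min _ (mem_entry lt_li).
by rewrite -{1}Dl col // => /(_ isT); rewrite leqNgt -Dm row.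
Qed.

Lemma processed_fold P ms sh n st :
  decreasing_tableau P ->
  (forall i, i < n ->
    least_above (trow P i) (nth 0 ms i.+1) (nth 0 ms i) /\
    forall k, k < size (trow P i.+1) -> entry P i k = nth 0 ms i ->
      entry P i.+1 k <= nth 0 ms i.+1) ->
  processed_from P ms sh n st ->
  processed_from P ms sh 0 (foldr (process_row P ms) st (iota 0 n)).
Proof.
move=> decP; elim: n st => // n IHn st msP inv.
(* [foldr] starts at the end of the list: row [n] is processed first, and the rows above it are left
   to the induction. *)
rewrite -addn1 iotaD foldr_cat; apply: IHn => [i lt_in|].
  exact/msP/ltnW.
by have [? ?] := msP n (ltnSn n); apply: processed_step.
Qed.

(** * Deleting a removable cell *)

Lemma removable_size P r c :
  removable P r c -> size (trow P r) = c.+1 /\ size (trow P r.+1) <= c.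
Proof.
case/and3P; rewrite /in_diagram /= !nth_shape -!leqNgt => lt_c le_c ->.
by split=> //; apply/eqP; rewrite eqn_leq le_c.
Qed.

(** The filter in [delete_cell] acts only when [c = 0]. Then row [r] is the last one, so dropping it
    shifts no other row, and the default [[::]] agrees with [take 0]. *)
Lemma trow_delete P r c i :
  is_partition (shape P) -> removable P r c ->
  trow (delete_cell P r c) i = if i == r then take c (trow P r) else trow P i.
Proof.
move=> part /removable_size[sz_r sz_r1].
have lt_rP : r < size P by rewrite -trow_neq0 // sz_r.
have [c0 | c_gt0] := posnP c; last first.
  rewrite /delete_cell (all_filterP _) => [|]; last first.
    apply/allP=> R /(nthP [::])[j]; rewrite size_set_nth (maxn_idPr lt_rP).
    rewrite -size_eq0 -lt0n nth_set_nth /= => lt_j <-; case: eqP => _.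
      by rewrite size_take sz_r ltnSn.
    by rewrite trow_neq0.
  by rewrite /trow nth_set_nth.
move: sz_r1; rewrite c0 leqNgt trow_neq0 // -leqNgt => le_Pr.
have {le_Pr} szP : size P = r.+1 by apply/eqP; rewrite eqn_leq le_Pr.
have -> : delete_cell P r 0 = take r P.
  rewrite /delete_cell take0 set_nthE lt_rP drop_oversize ?szP //.
  rewrite filter_cat /= cats0; apply/all_filterP/allP=> R /mem_take PR.
  by case/is_partition_shape: part => noNil _; apply: contra noNil => /eqP <-.
rewrite take0 /trow; case: (ltngtP i r) => [lt_ir|lt_ri|->].
- by rewrite nth_take.
- by rewrite !nth_default ?szP // size_takel ?szP // ltnW.
- by rewrite nth_default // size_takel ?szP.
Qed.

Lemma is_partition_delete P r c :
  is_partition (shape P) -> removable P r c ->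
  is_partition (shape (delete_cell P r c)).
Proof.
move=> part rmv; have [sz_r sz_r1] := removable_size rmv.
apply/is_partition_shape; split=> [|i]; first by rewrite mem_filter.
have := size_trowS i part; rewrite !trow_delete //.
case: (i =P r) => [->|_]; first by rewrite gtn_eqF // size_takel ?sz_r.
by case: eqP => [->|//]; rewrite sz_r size_takel ?sz_r // => /ltnW.
Qed.

Lemma processed_delete P ms r c :
  decreasing_tableau P -> removable P r c -> nth 0 ms r = entry P r c ->
  processed_from P ms (shape (delete_cell P r c)) r (delete_cell P r c, true).
Proof.
case/decreasing_tableauP=> part pos row col rmv ms_r.
have [sz_r sz_r1] := removable_size rmv.
have eq_row i := trow_delete i part rmv.
have sub_e i k : k < size (trow (delete_cell P r c) i) ->
    k < size (trow P i) /\ entry (delete_cell P r c) i k = entry P i k.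
  rewrite /entry eq_row; case: eqP => // ->; rewrite size_takel ?sz_r // => lt_k.
  by rewrite nth_take // ltnW.
split; split=> //=.
- by move=> j lt_jr; rewrite eq_row ltn_eqF.
- by move=> j k _ /sub_e[lt_k ->]; apply: pos.
- move=> j k l _ lt_l lt_kl; have [_ ->] := sub_e _ _ (ltn_trans lt_kl lt_l).
  by have [lt_lP ->] := sub_e _ _ lt_l; apply: row.
- move=> j k le_rj lt_k; have [lt_kP ->] := sub_e _ _ lt_k.
  have [|_ ->] := sub_e j k; last exact: col.
  exact: leq_trans lt_k (size_trowS j (is_partition_delete part rmv)).
- by move=> k /sub_e[-> ->].
- by rewrite ms_r pos ?sz_r.
(* The deleted entry was the last of a strictly decreasing row, so it no longer occurs there and the
   clause is vacuous. *)
- move=> _; rewrite ms_r => /mem_trow[k lt_k]; have [lt_kP ->] := sub_e _ _ lt_k.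
  move: lt_k; rewrite eq_row eqxx size_takel ?sz_r // => lt_kc eq_e.
  by have := row r k c; rewrite sz_r eq_e ltnn => /(_ (ltnSn c) lt_kc).
Qed.

(** * The start for alpha equal to 0, and the conclusion *)

Lemma processed_start P ms i :
  decreasing_tableau P -> processed_from P ms (shape P) i (P, false).
Proof.
case/decreasing_tableauP=> part pos row col; split; split=> //=.
- by move=> j k _; apply: pos.
- by move=> j k l _; apply: row.
- by move=> j k _; apply: col.
Qed.

Lemma processed_decreasing P ms sh st :
  is_partition sh -> processed_from P ms sh 0 st -> decreasing_tableau st.1.
Proof.
move=> part [[shP _ pos row col] _]; apply/decreasing_tableauP; split.
- by rewrite shP.
- by move=> i k; apply: pos.
- by move=> i k l; apply: row.
- by move=> i k; apply: col.
Qed.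

Theorem theorem3p2 (P : tableau) (r c : nat) (alpha : bool) :
  decreasing_tableau P ->
  removable P r c ->
  exists (P' : tableau) (m : nat),
    [/\ reverse_insertion P r c alpha = Some (P', m),
        decreasing_tableau P',
        alpha = false -> shape P' = shape P
      & alpha = true ->
          in_diagram (shape P') =1 [predD1 in_diagram (shape P) & (r, c)]].
Proof.
move=> decP rmv; have [sz_r sz_r1] := removable_size rmv.
have lt_c : c < size (trow P r) by rewrite sz_r.
have [ms [Dms ms_r ms_r1 msP]] := bumping_path_some decP lt_c.
case/decreasing_tableauP: (decP) => part pos row _.
have stepP i : i < r ->
    least_above (trow P i) (nth 0 ms i.+1) (nth 0 ms i) /\
    forall k, k < size (trow P i.+1) -> entry P i k = nth 0 ms i ->
      entry P i.+1 k <= nth 0 ms i.+1.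
  move=> lt_ir; have least_i := msP i lt_ir; split=> // k.
  apply: entry_below_least least_i _ => //.
  (* The path value of row [i.+1] occurs in that row, either as a bumped entry or, for [i.+1 = r],
     as the entry of the removable cell. *)
  have [lt_r | ge_r | Dr] := ltngtP i.+1 r; first by have [] := msP _ lt_r.
    by move: lt_ir; rewrite ltnNge -ltnS ge_r.
  by rewrite Dr ms_r mem_entry.
rewrite /reverse_insertion Dms /=; case: alpha.
  have inv := processed_fold decP stepP (processed_delete decP rmv ms_r).
  eexists; eexists; split=> [//||//|_ [i j]].
    exact: processed_decreasing (is_partition_delete part rmv) inv.
  have [[-> _ _ _ _] _] := inv.
  rewrite /= /in_diagram /= unfold_in /= !nth_shape trow_delete // xpair_eqE.
  case: eqP => [->|_] //=; rewrite size_takel ?sz_r // ltnS ltn_neqAle.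
  by [].
have stepP0 i : i < r.+1 ->
    least_above (trow P i) (nth 0 ms i.+1) (nth 0 ms i) /\
    forall k, k < size (trow P i.+1) -> entry P i k = nth 0 ms i ->
      entry P i.+1 k <= nth 0 ms i.+1.
  rewrite ltnS leq_eqVlt => /predU1P[->|]; last exact: stepP.
  (* At row [r] the path value below is the convention 0. The entry at [(r, c)] ends its row, so it
     is the smallest one there; and a cell of row [r.+1] has column less than [c], where row [r]
     holds a larger entry. *)
  rewrite ms_r ms_r1; split=> [|k lt_k Dk].
    split=> [||y /mem_trow[k lt_k <-] _]; [exact: mem_entry | exact: pos |].
    move: lt_k; rewrite sz_r ltnS leq_eqVlt => /predU1P[-> //| lt_kc].
    by rewrite ltnW // row.
  have lt_kc := leq_trans lt_k sz_r1.
  by have := row _ _ _ lt_c lt_kc; rewrite Dk ltnn.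
have inv := processed_fold decP stepP0 (processed_start ms r.+1 decP).
eexists; eexists; split=> //; first exact: processed_decreasing part inv.
by move=> _; have [[-> _ _ _ _] _] := inv.
Qed.
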